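(* Let $z_1,\dots,z_n$ be pairwise distinct complex numbers and $\boldsymbol l=(l_1,l_2)$ nonnegative integers. In the variables $(\boldsymbol u,\boldsymbol y)$, the $\mathfrak{sl}_3$ canonical weight function $\Psi(\boldsymbol t,\boldsymbol z,\boldsymbol u,\boldsymbol y)$ and its degree decomposition are given by $$\Psi(\boldsymbol t,\boldsymbol z,\boldsymbol u,\boldsymbol y)=u_1^{l_1}u_2^{l_2}\,\frac{\prod_{j=1}^{n-1}P_1(y_1^{(j)})P_2(y_2^{(j)})}{\prod_{s=1}^nP_1(z_s)P_2(z_s)}\Bigl[1+\sum_{d=1}^{\min(l_1,l_2)}\frac1{d!}\Bigl(\frac{u_3}{u_1u_2}\Bigr)^d\sum_{(\boldsymbol k,\boldsymbol m)\ d\text{-admissible}}\Xi_{(\boldsymbol k,\boldsymbol m)}(\boldsymbol t,\boldsymbol z,\boldsymbol y)\Bigr],$$ where $P_1(x)=\prod_{i=1}^{l_1}(t_i^{(1)}-x)$, $P_2(x)=\prod_{i=1}^{l_2}(t_i^{(2)}-x)$ and, for a $d$-admissible pair $(\boldsymbol k,\boldsymbol m)$, $$\Xi_{(\boldsymbol k,\boldsymbol m)}(\boldsymbol t,\boldsymbol z,\boldsymbol y)=\prod_{a=1}^d\Bigl(\frac1{t_{k_a}^{(1)}-t_{m_a}^{(2)}}\Bigl(\prod_{j=1}^{n-1}\frac{t_{k_a}^{(1)}-y_3^{(j)}}{(t_{k_a}^{(1)}-y_1^{(j)})(t_{m_a}^{(2)}-y_2^{(j)})}\Bigr)\prod_{s=1}^n(t_{m_a}^{(2)}-z_s)\Bigr).$$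 That is, the degree zero component of $\Psi$ is the prefactor, and for $1\le d\le\min(l_1,l_2)$ the degree $d$ component of $\Psi$ is the prefactor times the $d$-th summand in the bracket.
   Context: A pair $(\boldsymbol k,\boldsymbol m)$ is called $d$-admissible if $\boldsymbol k=(k_1,\dots,k_d)$ is an ordered tuple of distinct elements of $\{1,\dots,l_1\}$ and $\boldsymbol m=(m_1,\dots,m_d)$ is an ordered tuple of distinct elements of $\{1,\dots,l_2\}$. **Canonical weight function.** Let $\boldsymbol t=(t^{(1)}_1,\dots,t^{(1)}_{l_1},t^{(2)}_1,\dots,t^{(2)}_{l_2})$. Let $P(\boldsymbol l,n)$ be the set of collections $I=(i^j_{2,1},i^j_{3,1},i^j_{3,2})_{j=1,\dots,n}$ of nonnegative integers with $\sum_j(i^j_{2,1}+i^j_{3,1})=l_1$ and $\sum_j(i^j_{3,1}+i^j_{3,2})=l_2$. For $I\in P(\boldsymbol l,n)$ let $S(I)=\{(j,a,b,q): 1\le j\le n,\ 1\le b<a\le3,\ 1\le q\le i^j_{a,b}\}$, let $S_1(I)\subset S(I)$ consist of elements with $b=1$ and $S_2(I)$ of elements with $a=3$ (so $|S_i(I)|=l_i$), and let $B(I)$ be the set of pairs $\beta=(\beta_1,\beta_2)$ of bijections $\beta_i:S_i(I)\to\{1,\dots,l_i\}$. For $s=(j,a,b,q)$ put $\omega_{s,\beta}=\dfrac{1}{t^{(1)}_{\beta_1(s)}-z_j}$ if $(a,b)=(2,1)$; $\omega_{s,\beta}=\dfrac{1}{t^{(2)}_{\beta_2(s)}-z_j}$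 if $(a,b)=(3,2)$; $\omega_{s,\beta}=\dfrac1{(t^{(1)}_{\beta_1(s)}-z_j)(t^{(2)}_{\beta_2(s)}-t^{(1)}_{\beta_1(s)})}$ if $(a,b)=(3,1)$. Put $\omega_I=\dfrac{1}{\prod_{j}\prod_{a>b}(i^j_{a,b})!}\sum_{\beta\in B(I)}\prod_{s\in S(I)}\omega_{s,\beta}$. Here $e_{a,b}$ ($a\neq b$) are the standard generators of $\mathfrak{sl}_3$. The canonical weight function is $\omega_{\boldsymbol l,n}=\sum_{I\in P(\boldsymbol l,n)}\omega_I\,\bigotimes_{j=1}^n e_{2,1}^{i^j_{2,1}}e_{3,1}^{i^j_{3,1}}e_{3,2}^{i^j_{3,2}}v_{\Lambda_j}$, with values in the tensor product $M_{\Lambda_1}\otimes\dots\otimes M_{\Lambda_n}$ of $\mathfrak{sl}_3$ Verma modules with highest weights $\Lambda_j$ and highest weight vectors $v_{\Lambda_j}$. Under the identification of this tensor product with $\mathbb C[x_k^{(i)}]^{i=1,\dots,n}_{k=1,2,3}$ sending $\bigotimes_j e_{2,1}^{i^j_{2,1}}e_{3,1}^{i^j_{3,1}}e_{3,2}^{i^j_{3,2}}v_{\Lambda_j}$ to $\prod_j(x_1^{(j)})^{i^j_{2,1}}(x_3^{(j)})^{i^j_{3,1}}(x_2^{(j)})^{i^j_{3,2}}$, it becomes the polynomial in $\boldsymbol x$ $$\sum_{I\in P(\boldsymbol l,n)}\omega_I\prod_{j=1}^n(x_1^{(j)})^{i^j_{2,1}}(x_3^{(j)})^{i^j_{3,1}}(x_2^{(j)})^{i^j_{3,2}},$$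 with coefficients rational in $\boldsymbol t,\boldsymbol z$. $\Psi(\boldsymbol t,\boldsymbol z,\boldsymbol u,\boldsymbol y)$ is this function after the change of variables below. **Change of variables.** $\boldsymbol u=(u_1,u_2,u_3)$, $\boldsymbol y=(y_k^{(j)})_{k=1,2,3}^{j=1,\dots,n-1}$ are related to $\boldsymbol x=(x_k^{(i)})$ by $$\sum_{i=1}^n\frac{x_k^{(i)}}{t-z_i}=u_k\frac{\prod_{j=1}^{n-1}(t-y_k^{(j)})}{\prod_{i=1}^n(t-z_i)},\qquad k=1,2,3,$$ $t$ an auxiliary variable. **Degree.** A monomial in the $x_k^{(i)}$ has degree $d$ if its total degree in $x_3^{(1)},\dots,x_3^{(n)}$ is $d$; equivalently, in the variables $(\boldsymbol u,\boldsymbol y)$ the degree is the degree in $u_3$.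
   Formalization: The first factor of Ξ is taken as 1/(t^(2)_{m_a} − t^(1)_{k_a}) instead of the printed 1/(t^(1)_{k_a} − t^(2)_{m_a}); with the given weight function the printed sign fails for odd d, already for n=1, l=(1,1). *)

(* Defs.v *)
From HB Require Import structures.
From mathcomp Require Import all_boot all_order all_algebra.
From mathcomp Require Import reals.
From mathcomp Require Import fraction complex mpoly.

Set Implicit Arguments.
Unset Strict Implicit.
Unset Printing Implicit Defensive.

Import GRing.Theory.
Local Open Scope ring_scope.

(* The index k = 1, 2, 3 carried by the variables x_k^(j), u_k, y_k^(j). *)
Definition k1 : 'I_3 := @Ordinal 3 0 isT.
Definition k2 : 'I_3 := @Ordinal 3 1 isT.
Definition k3 : 'I_3 := @Ordinal 3 2 isT.

(* The pairs (a, b) with 3 >= a > b >= 1. *)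
Inductive root : predArgType := E21 | E31 | E32.

Definition root_a (r : root) : nat :=
  match r with E21 => 2 | E31 => 3 | E32 => 3 end.
Definition root_b (r : root) : nat :=
  match r with E21 => 1 | E31 => 1 | E32 => 2 end.

(* e_{2,1}, e_{3,1}, e_{3,2} correspond to x_1, x_3, x_2 respectively. *)
Definition root_var (r : root) : 'I_3 :=
  match r with E21 => k1 | E31 => k3 | E32 => k2 end.
Definition var_root (k : 'I_3) : root :=
  match val k with 0 => E21 | 1 => E32 | _ => E31 end%N.
Lemma root_varK : cancel root_var var_root.
Proof. by case. Qed.

HB.instance Definition _ := Equality.copy root (can_type root_varK).
HB.instance Definition _ := Choice.copy root (can_type root_varK).
HB.instance Definition _ := Countable.copy root (can_type root_varK).
HB.instance Definition _ := Finite.copy root (can_type root_varK).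

Section WeightFunction.
Variables (F : fieldType) (n l1 l2 : nat).
Variables (z : 'I_n -> F) (t1 : 'I_l1 -> F) (t2 : 'I_l2 -> F).

(* Each i^j_{a,b} of a collection in P(l, n) is at most l1 or at most l2, so
   bounding the entries by l1 + l2 excludes nothing. *)
Definition collection : Type := {ffun 'I_n * root -> 'I_(l1 + l2).+1}.

Definition in_P (I : collection) : bool :=
  (\sum_(j < n) (I (j, E21) + I (j, E31)) == l1)%N &&
  (\sum_(j < n) (I (j, E31) + I (j, E32)) == l2)%N.

(* (j, (a, b)) together with q < i^j_{a,b}; q is counted from 0. *)
Definition SI (I : collection) : Type := {p : 'I_n * root & 'I_(I p)}.
Definition SI1 (I : collection) : Type :=
  {s : SI I | root_b (tag s).2 == 1%N}.
Definition SI2 (I : collection) : Type :=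
  {s : SI I | root_a (tag s).2 == 3%N}.

Definition bijectiveb (A B : finType) (f : {ffun A -> B}) : bool :=
  injectiveb f && [forall b, b \in codom f].

(* The proofs isT place s in S_1 or S_2 according to its root. *)
Definition omega_factor (I : collection)
    (b1 : SI1 I -> 'I_l1) (b2 : SI2 I -> 'I_l2) (s : SI I) : F :=
  let: existT p q := s in
  match p return 'I_(I p) -> F with
  | (j, E21) => fun q =>
      let s' : SI I := existT _ (j, E21) q in
      1 / (t1 (b1 (exist _ s' isT)) - z j)
  | (j, E32) => fun q =>
      let s' : SI I := existT _ (j, E32) q in
      1 / (t2 (b2 (exist _ s' isT)) - z j)
  | (j, E31) => fun q =>
      let s' : SI I := existT _ (j, E31) q in
      let t1s := t1 (b1 (exist _ s' isT)) in
      let t2s := t2 (b2 (exist _ s' isT)) in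
      1 / ((t1s - z j) * (t2s - t1s))
  end q.

Definition omega (I : collection) : F :=
  1 / (\prod_(j < n) \prod_(r : root) (I (j, r))`!)%:R *
  \sum_(b : {ffun SI1 I -> 'I_l1} * {ffun SI2 I -> 'I_l2}
          | bijectiveb b.1 && bijectiveb b.2)
     \prod_(s : SI I) omega_factor b.1 b.2 s.

Definition xpoly : Type := {mpoly F[#|{: 'I_n * 'I_3}|]}.
Definition xvar (j : 'I_n) (k : 'I_3) : xpoly := 'X_(enum_rank (j, k)).

(* The canonical weight function, as a polynomial in the x_k^(j). *)
Definition weight_function : xpoly :=
  \sum_(I : collection | in_P I)
     omega I *: \prod_(j < n)
       (xvar j k1 ^+ I (j, E21) * xvar j k3 ^+ I (j, E31)
        * xvar j k2 ^+ I (j, E32)).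

Definition x3degree (m : 'X_{1..#|{: 'I_n * 'I_3}|}) : nat :=
  (\sum_(j < n) m (enum_rank (j, k3)))%N.

Definition degree_component (d : nat) (p : xpoly) : xpoly :=
  \sum_(m <- msupp p | x3degree m == d) p@_m *: 'X_[m].

Definition at_x (x : 'I_n -> 'I_3 -> F) (p : xpoly) : F :=
  p.@[fun i => x (enum_val i).1 (enum_val i).2].

(* Equality of rational functions of the auxiliary variable t = 'X. *)
Definition change_of_variables (x : 'I_n -> 'I_3 -> F)
    (u : 'I_3 -> F) (y : 'I_3 -> 'I_n.-1 -> F) : Prop :=
  let t : {fraction {poly F}} := tofrac 'X in
  let cst (c : F) : {fraction {poly F}} := tofrac c%:P in
  forall k : 'I_3,
    \sum_(i < n) cst (x i k) / (t - cst (z i)) =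
    cst (u k) * (\prod_(j < n.-1) (t - cst (y k j))
                 / \prod_(i < n) (t - cst (z i))).

Definition P1 (c : F) : F := \prod_(i < l1) (t1 i - c).
Definition P2 (c : F) : F := \prod_(i < l2) (t2 i - c).

Definition admissible (d : nat) (km : d.-tuple 'I_l1 * d.-tuple 'I_l2) : bool :=
  uniq km.1 && uniq km.2.

(* The first factor is 1 / (t2 - t1), not 1 / (t1 - t2): this is the sign
   carried by the (3, 1) factor in [omega_factor]. *)
Definition Xi (y : 'I_3 -> 'I_n.-1 -> F) (d : nat)
    (km : d.-tuple 'I_l1 * d.-tuple 'I_l2) : F :=
  \prod_(a < d)
    (let t1a := t1 (tnth km.1 a) in
     let t2a := t2 (tnth km.2 a) in
     1 / (t2a - t1a) *
     (\prod_(j < n.-1) ((t1a - y k3 j) / ((t1a - y k1 j) * (t2a - y k2 j)))) *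
     \prod_(s < n) (t2a - z s)).

End WeightFunction.

Section RationalFunctions.
Variables (R : realType) (n l1 l2 : nat).

(* The indeterminates t^(1)_i, t^(2)_i, u_k and y_k^(j). *)
Definition indets : finType :=
  ('I_l1 + 'I_l2 + 'I_3 + 'I_3 * 'I_n.-1)%type.

Definition ratfun : fieldType := {fraction {mpoly R[i][#|indets|]}}.

Definition indet (v : indets) : ratfun := tofrac 'X_(enum_rank v).
Definition t1_ (i : 'I_l1) : ratfun := indet (inl (inl (inl i))).
Definition t2_ (i : 'I_l2) : ratfun := indet (inl (inl (inr i))).
Definition u_ (k : 'I_3) : ratfun := indet (inl (inr k)).
Definition y_ (k : 'I_3) (j : 'I_n.-1) : ratfun := indet (inr (k, j)).
Definition const_ (c : R[i]) : ratfun := tofrac c%:MP.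

End RationalFunctions.

(* Main.v *)
Require Import Defs.
From HB Require Import structures.
From mathcomp Require Import all_boot all_order all_algebra.
From mathcomp Require Import reals.
From mathcomp Require Import fraction complex mpoly.
From mathcomp Require Import ring.

Set Implicit Arguments.
Unset Strict Implicit.
Unset Printing Implicit Defensive.

(* Write F_k(t) = sum_j x_k^(j) / (t - z_j).  The degree d component of the
   weight function is
     1/(d! p! q!) sum_(b1, b2)
       prod_(a < d) (F_3(t1_(b1 a)) / (t2_(b2 a) - t1_(b1 a)))
       * prod_(i < p) F_1(t1_(b1 i)) * prod_(i < q) F_2(t2_(b2 i)),
   with p = l1 - d, q = l2 - d and b1 : 'I_d + 'I_p -> 'I_l1,
   b2 : 'I_d + 'I_q -> 'I_l2 bijections.  Indeed, expanding each F_k chooses a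
   word in 'I_n for each of the three roots; the words of content I number
   d! p! q! / prod I!, and a word of content I identifies the index set of its
   letters with S(I), hence its contribution with omega_I times the monomial.
   Dividing by prod F_1(t1_i) prod F_2(t2_m) leaves a summand depending only on
   b1 and b2 restricted to 'I_d, whose extensions number p! q!; the change of
   variables then evaluates each F_k at the t's. *)

Import GRing.Theory.
Local Open Scope ring_scope.

(** * Words of prescribed content and the multinomial count *)

Definition content (N : nat) (T : finType) (v : {ffun 'I_N -> T}) (t : T) :
    nat :=
  (\sum_(i < N) (v i == t))%N.

Lemma sum_content (N : nat) (T : finType) (v : {ffun 'I_N -> T}) :
  (\sum_(t : T) content v t = N)%N.
Proof.
rewrite /content exchange_big /= -[RHS]card_ord -sum1_card.
apply: eq_bigr => i _; rewrite (bigD1 (v i)) //= eqxx big1 ?addn0 //.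
by move=> t /negPf ne_t; rewrite eq_sym ne_t.
Qed.

Definition fcons (N : nat) (T : finType) (t : T) (v : {ffun 'I_N -> T}) :
    {ffun 'I_N.+1 -> T} :=
  [ffun i => oapp v t (unlift ord0 i)].

Lemma content_fcons (N : nat) (T : finType) (t s : T) (v : {ffun 'I_N -> T}) :
  content (fcons t v) s = ((t == s) + content v s)%N.
Proof.
rewrite /content big_ord_recl /fcons ffunE unlift_none; congr addn.
by apply: eq_bigr => i _; rewrite ffunE liftK.
Qed.

Lemma fcons_bij (N : nat) (T : finType) :
  bijective (fun p : T * {ffun 'I_N -> T} => fcons p.1 p.2).
Proof.
exists (fun v : {ffun 'I_N.+1 -> T} =>
          (v ord0, [ffun i : 'I_N => v (lift ord0 i)])).
  case=> t v /=; rewrite ffunE unlift_none; congr pair.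
  by apply/ffunP=> i; rewrite !ffunE liftK.
by move=> v; apply/ffunP=> i; rewrite ffunE; case: unliftP => [j|] -> //=;
  rewrite ffunE.
Qed.

Lemma card_content (N : nat) (T : finType) (c : T -> nat) :
  (\sum_(t : T) c t = N ->
   #|[set v : {ffun 'I_N -> T} | [forall t, content v t == c t]]|
     * \prod_(t : T) (c t)`! = N`!)%N.
Proof.
elim: N c => [|N IHN] c sum_c.
  have c0 t : c t = 0%N.
    by apply/eqP; move/eqP: sum_c; rewrite sum_nat_eq0 => /forallP /(_ t).
  rewrite big1 => [|t _]; last by rewrite c0.
  rewrite muln1 (_ : [set _ | _] = setT) ?cardsT ?card_ffun ?card_ord //.
  by apply/setP=> v; rewrite !inE; apply/forallP=> t;
    rewrite /content big_ord0 c0.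
rewrite cardsE -sum1_card (reindex _ (onW_bij _ (@fcons_bij N T))) /=.
rewrite -(pair_big_dep xpredT
  (fun t v => [forall s, content (fcons t v) s == c s])
  (fun _ _ => 1%N)) /=.
rewrite big_distrl factS.
transitivity (\sum_(t : T) c t * N`!)%N; last by rewrite -sum_c big_distrl.
apply: eq_bigr => t _.
(* If [c t = 0], no word of content [c] starts with [t], and both sides vanish. *)
rewrite sum1_card; have [ct0|ct_gt0] := posnP (c t).
  rewrite [c t]ct0 mul0n eq_card0 // => v.
  rewrite -[LHS]/[forall s, content (fcons t v) s == c s].
  apply/negbTE/negP => /forallP/(_ t).
  by rewrite content_fcons eqxx ct0.
(* [c'] is the content left for the tail once the first letter [t] is removed. *)
pose c' s := (c s - (t == s))%N.
have c'E s : c s = ((t == s) + c' s)%N.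
  by rewrite subnKC //; case: eqP => // <-.
rewrite -(IHN c'); last first.
  apply/eqP; rewrite -eqSS -sum_c (bigD1 t) //= [in eqbRHS](bigD1 t) //=.
  rewrite [in eqbRHS](c'E t) eqxx -addSn; apply/eqP; congr addn.
  by apply: eq_bigr => s /negPf ne_s; rewrite c'E eq_sym ne_s.
have -> : (\prod_s (c s)`! = c t * \prod_s (c' s)`!)%N.
  rewrite (bigD1 t) //= [in RHS](bigD1 t) //=.
  rewrite (_ : c' t = (c t).-1) ?/c' ?eqxx ?subn1 // mulnA.
  rewrite -{1}(prednK ct_gt0) factS (prednK ct_gt0); congr muln.
  by apply: eq_bigr => s /negPf ne_s; rewrite eq_sym ne_s subn0.
rewrite [LHS]mulnCA; congr (_ * (_ * _))%N.
apply: eq_card => v; rewrite inE.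
rewrite -[LHS]/[forall s, content (fcons t v) s == c s]; apply: eq_forallb => s.
by rewrite content_fcons c'E eqn_add2l.
Qed.

(** * Bijections from equal fibers, and extensions of injections *)

Lemma bijection_of_fibers (A B P : finType) (f : A -> P) (g : B -> P) :
  (forall p, #|[pred a | f a == p]| = #|[pred b | g b == p]|) ->
  exists2 h : A -> B, bijective h & forall a, g (h a) = f a.
Proof.
move=> eq_fg.
(* [Q a b] pairs [a] with the element of equal rank in the fiber of [g] over [f a]; ranks determine
   elements, so the resulting map is injective. *)
pose Q a b := (g b == f a) &&
  (index b (enum [pred b | g b == f a]) == index a (enum [pred a' | f a' == f a])).
have exQ a : exists b, Q a b.
  set eA := enum [pred a' | f a' == f a]; set eB := enum [pred b | g b == f a].
  have szAB : size eA = size eB by rewrite -!cardE eq_fg.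
  have lt_a : (index a eA < size eB)%N.
    by rewrite -szAB index_mem mem_enum inE.
  case eBE : eB lt_a => [|b0 s] // lt_a; rewrite -eBE in lt_a.
  exists (nth b0 eB (index a eA)); rewrite /Q -/eA -/eB index_uniq ?enum_uniq //.
  by rewrite eqxx andbT; move: (mem_nth b0 lt_a); rewrite mem_enum inE.
pose h a := xchoose (exQ a).
have hQ a : Q a (h a) := xchooseP (exQ a).
have gh a : g (h a) = f a by case/andP: (hQ a) => /eqP.
exists h => //; apply: inj_card_bij; last first.
  (* Adding up the fibers over [P] bounds the cardinal of [B] by that of [A], which turns
     injectivity into bijectivity. *)
  rewrite -[X in (X <= _)%N]sum1_card -[X in (_ <= X)%N]sum1_card.
  rewrite (partition_big g xpredT) // [X in (_ <= X)%N](partition_big f xpredT) //=.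
  apply: leq_sum => p _; rewrite !sum1_card.
  by have := eq_fg p; rewrite /= => /eqP; rewrite eqn_leq => /andP[].
move=> a a' eq_h; have eq_f : f a = f a' by rewrite -!gh eq_h.
have /andP[_ /eqP] := hQ a; have /andP[_ /eqP] := hQ a'.
by rewrite eq_h eq_f => -> /index_inj -> //; rewrite mem_enum inE ?eq_f.
Qed.

Definition ffun_cat (A B T : finType) (f : {ffun A -> T}) (g : {ffun B -> T}) :
    {ffun A + B -> T} :=
  [ffun s => match s with inl a => f a | inr b => g b end].

Definition ffun_inl (A B T : finType) (f : {ffun A + B -> T}) : {ffun A -> T} :=
  [ffun a => f (inl a)].

Lemma ffun_cat_bij (A B T : finType) :
  bijective (fun p : {ffun A -> T} * {ffun B -> T} => ffun_cat p.1 p.2).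
Proof.
exists (fun f : {ffun A + B -> T} => (ffun_inl f, [ffun b => f (inr b)])).
  by case=> f g /=; congr pair; apply/ffunP=> s; rewrite !ffunE.
by move=> f; apply/ffunP=> -[s|s]; rewrite /= !ffunE.
Qed.

Lemma ffun_catK (A B T : finType) (f : {ffun A -> T}) (g : {ffun B -> T}) :
  ffun_inl (ffun_cat f g) = f.
Proof. by apply/ffunP=> a; rewrite !ffunE. Qed.

Lemma injectiveb_cat (A B T : finType) (f : {ffun A -> T}) (g : {ffun B -> T}) :
  injectiveb (ffun_cat f g) =
  [&& injectiveb f, injectiveb g & g \in ffun_on [predC codom f]].
Proof.
apply/injectiveP/and3P => [inj_fg|[/injectiveP inj_f /injectiveP inj_g]].
  split.
  - apply/injectiveP=> a a' eq_f; have := inj_fg (inl a) (inl a').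
    by rewrite !ffunE => /(_ eq_f) [].
  - apply/injectiveP=> b b' eq_g; have := inj_fg (inr b) (inr b').
    by rewrite !ffunE => /(_ eq_g) [].
  - apply/ffun_onP=> b; rewrite !inE; apply/codomP => -[a eq_gf].
    by have := inj_fg (inr b) (inl a); rewrite !ffunE => /(_ eq_gf).
move=> /ffun_onP g_f s s'; rewrite !ffunE.
case: s s' => [a|b] [a'|b'].
- by move/inj_f ->.
- by move=> eq_fg; have := g_f b'; rewrite !inE -eq_fg codom_f.
- by move=> eq_fg; have := g_f b; rewrite !inE eq_fg codom_f.
- by move/inj_g ->.
Qed.

Lemma sum_injective_cat (R : pzSemiRingType) (A B T : finType)
    (H : {ffun A -> T} -> R) :
  #|T| = (#|A| + #|B|)%N ->
  \sum_(f : {ffun A + B -> T} | injectiveb f) H (ffun_inl f) =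
  (#|B|`!)%:R * \sum_(f : {ffun A -> T} | injectiveb f) H f.
Proof.
move=> cardT; rewrite (reindex _ (onW_bij _ (@ffun_cat_bij A B T))) /=.
under eq_bigl do rewrite injectiveb_cat.
rewrite -(pair_big_dep (fun f : {ffun A -> T} => injectiveb f)
  (fun f (g : {ffun B -> T}) => injectiveb g && (g \in ffun_on [predC codom f]))
  (fun f g => H (ffun_inl (ffun_cat f g)))) /= mulr_sumr.
apply: eq_bigr => f inj_f; under eq_bigr do rewrite ffun_catK.
rewrite sumr_const mulr_natl; congr (_ *+ _).
transitivity #|[set g : {ffun B -> T} in ffun_on [predC codom f] | injectiveb g]|.
  by apply: eq_card => g; rewrite inE andbC.
rewrite card_inj_ffuns_on (_ : #|[predC codom f]| = #|B|) ?ffactnn //.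
apply/eqP; rewrite -(eqn_add2l #|codom f|) cardC cardT.
by rewrite card_codom //; apply/injectiveP.
Qed.

Lemma bijectiveb_card (A B : finType) (f : {ffun A -> B}) :
  #|A| = #|B| -> bijectiveb f = injectiveb f.
Proof.
move=> eqAB; rewrite /bijectiveb; case: injectiveP => //= inj_f.
by apply/forallP=> b; apply: inj_card_onto => //; rewrite eqAB.
Qed.

Lemma bijectiveb_comp (A A' B : finType) (h : A' -> A) (f : {ffun A -> B}) :
  bijective h -> bijectiveb [ffun a => f (h a)] = bijectiveb f.
Proof.
case=> h' hK h'K; apply/andP/andP => -[/injectiveP inj_f /forallP onto_f].
  split.
    apply/injectiveP=> a a' eq_f; apply: (can_inj h'K); apply: inj_f.
    by rewrite !ffunE !h'K.
  apply/forallP=> b; have /codomP[a ->] := onto_f b.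
  by rewrite ffunE codom_f.
split.
  apply/injectiveP=> a a'; rewrite !ffunE => /inj_f.
  exact: can_inj hK _ _.
apply/forallP=> b; have /codomP[a ->] := onto_f b.
by apply/codomP; exists (h' a); rewrite ffunE h'K.
Qed.

Lemma ffun_comp_bij (A A' B : finType) (h : A' -> A) :
  bijective h -> bijective (fun f : {ffun A -> B} => [ffun a => f (h a)]).
Proof.
case=> h' hK h'K; exists (fun f : {ffun A' -> B} => [ffun a => f (h' a)]).
  by move=> f; apply/ffunP=> a; rewrite !ffunE h'K.
by move=> f; apply/ffunP=> a; rewrite !ffunE hK.
Qed.

Lemma card_tag_fiber (T : finType) (N : T -> nat) (p : T) :
  #|[pred s : {p : T & 'I_(N p)} | tag s == p]| = N p.
Proof.
rewrite -sum1_card; transitivity (\sum_(q | q == p) \sum_(i < N q) 1)%N.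
  rewrite (sig_big_dep (pred1 p) (fun q => xpredT) (fun q _ => 1%N)) /=.
  by apply: eq_bigl => s; rewrite andbT.
by rewrite big_pred1_eq sum1_card card_ord.
Qed.

(** * Replacing S(I) by the positions of three words *)

Section Transport.
Variables (F : fieldType) (n l1 l2 : nat).
Variables (z : 'I_n -> F) (t1 : 'I_l1 -> F) (t2 : 'I_l2 -> F).
Implicit Types (I : collection n l1 l2).

(** This and the next two lemmas free [omega_factor] from the proofs [isT]: membership in S_1 or S_2
    is a boolean condition, so any element lying over [s] may be used. *)
Lemma omega_factor21 I (b1 : SI1 I -> 'I_l1) (b2 : SI2 I -> 'I_l2)
    (s : SI I) (s1 : SI1 I) (j : 'I_n) :
  tag s = (j, E21) -> val s1 = s ->
  omega_factor z t1 t2 b1 b2 s = 1 / (t1 (b1 s1) - z j).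
Proof.
case: s => -[j' []] q //= [<-] s1E; rewrite /omega_factor.
by congr (1 / (t1 (b1 _) - _)); apply: val_inj; exact: esym s1E.
Qed.

Lemma omega_factor32 I (b1 : SI1 I -> 'I_l1) (b2 : SI2 I -> 'I_l2)
    (s : SI I) (s2 : SI2 I) (j : 'I_n) :
  tag s = (j, E32) -> val s2 = s ->
  omega_factor z t1 t2 b1 b2 s = 1 / (t2 (b2 s2) - z j).
Proof.
case: s => -[j' []] q //= [<-] s2E; rewrite /omega_factor.
by congr (1 / (t2 (b2 _) - _)); apply: val_inj; exact: esym s2E.
Qed.

Lemma omega_factor31 I (b1 : SI1 I -> 'I_l1) (b2 : SI2 I -> 'I_l2)
    (s : SI I) (s1 : SI1 I) (s2 : SI2 I) (j : 'I_n) :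
  tag s = (j, E31) -> val s1 = s -> val s2 = s ->
  omega_factor z t1 t2 b1 b2 s =
  1 / ((t1 (b1 s1) - z j) * (t2 (b2 s2) - t1 (b1 s1))).
Proof.
case: s => -[j' []] q //= [<-] s1E s2E; rewrite /omega_factor.
by congr (1 / ((t1 (b1 _) - _) * (t2 (b2 _) - t1 (b1 _))));
  apply: val_inj; apply: esym.
Qed.

Variables d p q : nat.
Variables (vD : {ffun 'I_d -> 'I_n}) (vA : {ffun 'I_p -> 'I_n}).
Variable vB : {ffun 'I_q -> 'I_n}.

(** The positions of the three words stand for S(I): ['I_d] carries the root (3,1), ['I_p] the root
    (2,1), ['I_q] the root (3,2). Hence S_1 corresponds to ['I_d + 'I_p] and S_2 to
    ['I_d + 'I_q]. *)
Definition word_type (s : 'I_d + 'I_p + 'I_q) : 'I_n * Defs.root :=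
  match s with
  | inl (inl a) => (vD a, E31)
  | inl (inr b) => (vA b, E21)
  | inr e => (vB e, E32)
  end.

Definition word_weight (b1 : {ffun 'I_d + 'I_p -> 'I_l1})
    (b2 : {ffun 'I_d + 'I_q -> 'I_l2}) : F :=
  (\prod_(a < d) (1 / ((t1 (b1 (inl a)) - z (vD a))
                       * (t2 (b2 (inl a)) - t1 (b1 (inl a)))))) *
  (\prod_(i < p) (1 / (t1 (b1 (inr i)) - z (vA i)))) *
  (\prod_(i < q) (1 / (t2 (b2 (inr i)) - z (vB i)))).

Lemma word_type_fiber I :
  content vD =1 (fun j => I (j, E31)) -> content vA =1 (fun j => I (j, E21)) ->
  content vB =1 (fun j => I (j, E32)) ->
  forall jr, #|[pred s | word_type s == jr]| = I jr.
Proof.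
move=> cD cA cB [j r].
transitivity (\sum_s (word_type s == (j, r)))%N.
  by rewrite -sum1_card big_mkcond; apply: eq_bigr => s _;
    rewrite inE; case: eqP.
rewrite !big_sumType /=; under eq_bigr do rewrite xpair_eqE.
under [X in (_ + X + _)%N]eq_bigr do rewrite xpair_eqE.
under [X in (_ + X)%N]eq_bigr do rewrite xpair_eqE.
(* Only the word attached to the root [r] contributes to the fiber over [(j, r)]. *)
have no (N : nat) (f : 'I_N -> bool) : (\sum_i (f i && false) = 0)%N.
  by rewrite big1 // => i _; rewrite andbF.
have yes (N : nat) (f : 'I_N -> bool) : (\sum_i (f i && true) = \sum_i f i)%N.
  by apply: eq_bigr => i _; rewrite andbT.
by case: r; rewrite !no yes ?addn0 ?add0n -?cA -?cD -?cB.
Qed.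

(** The fibers of [word_type] and of [tag] over [jr] both have [I jr] elements, so the positions
    biject with S(I) compatibly with types. This bijection restricts to S_1 and S_2, and the pairs
    of bijections are reindexed along the restrictions. *)
Lemma sum_omega_factor I :
  content vD =1 (fun j => I (j, E31)) -> content vA =1 (fun j => I (j, E21)) ->
  content vB =1 (fun j => I (j, E32)) ->
  \sum_(b : {ffun SI1 I -> 'I_l1} * {ffun SI2 I -> 'I_l2}
        | bijectiveb b.1 && bijectiveb b.2)
     \prod_(s : SI I) omega_factor z t1 t2 b.1 b.2 s =
  \sum_(b : {ffun 'I_d + 'I_p -> 'I_l1} * {ffun 'I_d + 'I_q -> 'I_l2}
        | bijectiveb b.1 && bijectiveb b.2) word_weight b.1 b.2.
Proof.
move=> cD cA cB.
have [jr|h h_bij tag_h] :=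
    @bijection_of_fibers _ (SI I) _ word_type (fun s => tag s).
  by rewrite (word_type_fiber cD cA cB) card_tag_fiber.
have h1P (s : 'I_d + 'I_p) : root_b (tag (h (inl s))).2 == 1%N.
  by rewrite tag_h; case: s.
pose e2 (s : 'I_d + 'I_q) : 'I_d + 'I_p + 'I_q :=
  match s with inl a => inl (inl a) | inr b => inr b end.
have e2_inj : injective e2 by move=> [a|b] [a'|b'] //= [->].
have h2P (s : 'I_d + 'I_q) : root_a (tag (h (e2 s))).2 == 3%N.
  by rewrite tag_h; case: s.
pose h1 s : SI1 I := exist _ (h (inl s)) (h1P s).
pose h2 s : SI2 I := exist _ (h (e2 s)) (h2P s).
have [h' hK h'K] := h_bij.
have h1_bij : bijective h1.
  have sP (s : SI1 I) : exists u, h1 u == s.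
    case s => s0 s0P; have := tag_h (h' s0); rewrite h'K.
    (* A position in ['I_q] has root (3,2), which is excluded from S_1. *)
    case E : (h' s0) => [u|u]; last by move=> tagE; have := s0P; rewrite tagE.
    by move=> _; exists u; rewrite -val_eqE /= -E h'K.
  exists (fun s => xchoose (sP s)) => [u|s].
    by have /eqP/(congr1 val)/(can_inj hK) [] := xchooseP (sP (h1 u)).
  exact/eqP/(xchooseP (sP s)).
have h2_bij : bijective h2.
  have sP (s : SI2 I) : exists u, h2 u == s.
    case s => s0 s0P; have := tag_h (h' s0); rewrite h'K.
    case E : (h' s0) => [[a|b]|u] /=.
    - by move=> _; exists (inl a); rewrite -val_eqE /= -E h'K.
    - by move=> tagE; have := s0P; rewrite tagE.
    - by move=> _; exists (inr u); rewrite -val_eqE /= -E h'K.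
  exists (fun s => xchoose (sP s)) => [u|s].
    by have /eqP/(congr1 val)/(can_inj hK)/e2_inj := xchooseP (sP (h2 u)).
  exact/eqP/(xchooseP (sP s)).
have [g1 g1K Kg1] := @ffun_comp_bij _ _ 'I_l1 _ h1_bij.
have [g2 g2K Kg2] := @ffun_comp_bij _ _ 'I_l2 _ h2_bij.
rewrite [RHS](reindex (fun b : {ffun SI1 I -> 'I_l1} * {ffun SI2 I -> 'I_l2} =>
    ([ffun s => b.1 (h1 s)], [ffun s => b.2 (h2 s)]))) /=; last first.
  exists (fun b => (g1 b.1, g2 b.2)) => -[b1 b2] _ /=.
    by rewrite g1K g2K.
  by congr pair; [exact: Kg1|exact: Kg2].
apply: eq_big => [[b1 b2]|[b1 b2] _] /=; first by rewrite !bijectiveb_comp.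
rewrite (reindex _ (onW_bij _ h_bij)) /= !big_sumType /= /word_weight.
congr (_ * _ * _); apply: eq_bigr => a _; rewrite !ffunE.
- exact: (omega_factor31 _ _ (tag_h (inl (inl a)))).
- exact: (omega_factor21 _ _ (tag_h (inl (inr a)))).
- exact: (omega_factor32 _ _ (tag_h (inr a))).
Qed.

End Transport.

(** * Expanding products of Cauchy sums over words *)

Lemma prod_content (R : comPzSemiRingType) (N : nat) (T : finType)
    (f : T -> R) (v : {ffun 'I_N -> T}) :
  \prod_(i < N) f (v i) = \prod_(t : T) f t ^+ content v t.
Proof.
under [RHS]eq_bigr do rewrite /content -prodrXr.
rewrite exchange_big; apply: eq_bigr => i _ /=.
rewrite (bigD1 (v i)) //= eqxx big1 ?mulr1 // => t /negPf ne_t.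
by rewrite eq_sym ne_t.
Qed.

(** The order k1, k3, k2 is that of the factors in [weight_function]; it matches the order of the
    roots in [big_root]. *)
Lemma big_k (R : Type) (idx : R) (op : Monoid.com_law idx) (f : 'I_3 -> R) :
  \big[op/idx]_(k : 'I_3) f k = op (op (f k1) (f k3)) (f k2).
Proof.
rewrite !big_ord_recl big_ord0 Monoid.mulm1 -Monoid.mulmA.
congr (op (f _) _); first exact: val_inj.
by rewrite Monoid.mulmC; congr (op (f _) (f _)); exact: val_inj.
Qed.

Lemma big_root (R : Type) (idx : R) (op : Monoid.com_law idx)
    (f : Defs.root -> R) :
  \big[op/idx]_(r : Defs.root) f r = op (op (f E21) (f E31)) (f E32).
Proof.
have var_rootK : cancel var_root root_var.
  by case=> [[|[|[|//]]] lt_k] //=; apply: val_inj.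
rewrite (reindex var_root) /= ?big_k //.
by exists root_var => ? _; [exact: var_rootK|exact: root_varK].
Qed.

Lemma leq_content (N : nat) (T : finType) (v : {ffun 'I_N -> T}) (t : T) :
  (content v t <= N)%N.
Proof. by rewrite -[leqRHS](sum_content v) (bigD1 t) //= leq_addr. Qed.

Section Words.
Variables (F : fieldType) (n l1 l2 d p q : nat).
Variables (z : 'I_n -> F) (t1 : 'I_l1 -> F) (t2 : 'I_l2 -> F).
Variables (x : 'I_n -> 'I_3 -> F).
Hypotheses (dp : (d + p = l1)%N) (dq : (d + q = l2)%N).
Hypothesis fact_neq0 : forall m, (m`!)%:R != 0 :> F.

Definition words : finType :=
  ({ffun 'I_d -> 'I_n} * {ffun 'I_p -> 'I_n} * {ffun 'I_q -> 'I_n})%type.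

(** The multiplicities are at most d, p or q, hence at most l1 + l2, so [inord] truncates
    nothing. *)
Definition word_content (v : words) : collection n l1 l2 :=
  [ffun jr => inord
    match jr.2 with
    | E21 => content v.1.2 jr.1
    | E31 => content v.1.1 jr.1
    | E32 => content v.2 jr.1
    end].

Lemma word_contentE (v : words) (j : 'I_n) :
  [/\ word_content v (j, E21) = content v.1.2 j :> nat,
      word_content v (j, E31) = content v.1.1 j :> nat
    & word_content v (j, E32) = content v.2 j :> nat].
Proof.
split; rewrite ffunE /= inordK // ltnS.
- apply: leq_trans (leq_content _ _) _.
  by rewrite -dp -addnA addnCA leq_addr.
- apply: leq_trans (leq_content _ _) _.
  by rewrite -dp -addnA leq_addr.
- apply: leq_trans (leq_content _ _) _.
  by rewrite -dq addnA leq_addl.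
Qed.

Definition monomial_value (I : collection n l1 l2) : F :=
  \prod_(j < n) (x j k1 ^+ I (j, E21) * x j k3 ^+ I (j, E31)
                 * x j k2 ^+ I (j, E32)).

Definition cauchy_sum (k : 'I_3) (c : F) : F := \sum_(j < n) x j k / (c - z j).

(** This is the degree in the variables x_3 of the monomial attached to [I]. *)
Definition degree31 (I : collection n l1 l2) : nat :=
  (\sum_(j < n) I (j, E31))%N.

Lemma in_P_word_content (v : words) :
  in_P (word_content v) && (degree31 (word_content v) == d).
Proof.
have e21 : (\sum_(j < n) word_content v (j, E21) = p)%N.
  by rewrite -[RHS](sum_content v.1.2); apply: eq_bigr => j _;
    case: (word_contentE v j).
have e31 : (\sum_(j < n) word_content v (j, E31) = d)%N.
  by rewrite -[RHS](sum_content v.1.1); apply: eq_bigr => j _;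
    case: (word_contentE v j).
have e32 : (\sum_(j < n) word_content v (j, E32) = q)%N.
  by rewrite -[RHS](sum_content v.2); apply: eq_bigr => j _;
    case: (word_contentE v j).
by rewrite /in_P !big_split /= /degree31 e21 e31 e32 -dp -dq addnC !eqxx.
Qed.

Lemma word_content_eq (v : words) (I : collection n l1 l2) :
  (word_content v == I) =
  [&& [forall j, content v.1.1 j == I (j, E31)],
      [forall j, content v.1.2 j == I (j, E21)]
    & [forall j, content v.2 j == I (j, E32)]].
Proof.
apply/eqP/and3P => [<-|[/forallP cD /forallP cA /forallP cB]].
  by split; apply/forallP=> j; have [eA eD eB] := word_contentE v j;
    rewrite ?eA ?eD ?eB.
apply/ffunP=> -[j r]; apply: ord_inj.
have [eA eD eB] := word_contentE v j.
by case: r; rewrite ?eA ?eD ?eB; apply/eqP.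
Qed.

(** The degree condition forces the three words to have lengths d, p and q; they are chosen
    independently, so three multinomial counts multiply. *)
Lemma card_word_content (I : collection n l1 l2) :
  in_P I -> degree31 I = d ->
  (#|[pred v | word_content v == I]|
     * \prod_(j < n) \prod_(r : Defs.root) (I (j, r))`! = d`! * p`! * q`!)%N.
Proof.
move=> /andP[/eqP sum1 /eqP sum2] deg_I.
move: sum1 sum2; rewrite !big_split /= -/(degree31 I) deg_I => sum1 sum2.
have sumA : (\sum_(j < n) I (j, E21) = p)%N.
  by apply/eqP; rewrite -(eqn_add2l d) dp addnC sum1.
have sumB : (\sum_(j < n) I (j, E32) = q)%N.
  by apply/eqP; rewrite -(eqn_add2l d) dq sum2.
pose P N r := [pred v : {ffun 'I_N -> 'I_n} | [forall j, content v j == I (j, r)]].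
have cP N r : (\sum_(j < n) I (j, r) = N ->
    #|P N r| * \prod_(j < n) (I (j, r))`! = N`!)%N.
  by move/card_content; rewrite cardsE.
under [X in (_ * X)%N]eq_bigr do rewrite big_root /=.
rewrite !big_split /= -(cP _ _ deg_I) -(cP _ _ sumA) -(cP _ _ sumB).
have -> : #|[pred v | word_content v == I]| = (#|P d E31| * #|P p E21| * #|P q E32|)%N.
  rewrite -!cardX; apply: eq_card => v.
  by rewrite !inE word_content_eq andbA.
by rewrite mulnACA; congr (_ * _)%N; rewrite [X in (_ * X)%N]mulnC mulnACA.
Qed.

Lemma omega_words :
  \sum_(I | in_P I && (degree31 I == d)) omega z t1 t2 I * monomial_value I =
  1 / (d`! * p`! * q`!)%:R *
  \sum_(b : {ffun 'I_d + 'I_p -> 'I_l1} * {ffun 'I_d + 'I_q -> 'I_l2}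
        | bijectiveb b.1 && bijectiveb b.2)
    ((\prod_(a < d) (cauchy_sum k3 (t1 (b.1 (inl a)))
                     / (t2 (b.2 (inl a)) - t1 (b.1 (inl a))))) *
     (\prod_(i < p) cauchy_sum k1 (t1 (b.1 (inr i)))) *
     (\prod_(i < q) cauchy_sum k2 (t2 (b.2 (inr i))))).
Proof.
pose xw (v : words) := \prod_(a < d) x (v.1.1 a) k3
  * \prod_(i < p) x (v.1.2 i) k1 * \prod_(i < q) x (v.2 i) k2.
(* Distributing the products over the sums picks one letter per position; [xw] collects the
   numerators and [word_weight] the denominators. *)
have expand (b : {ffun 'I_d + 'I_p -> 'I_l1} * {ffun 'I_d + 'I_q -> 'I_l2}) :
    ((\prod_(a < d) (cauchy_sum k3 (t1 (b.1 (inl a)))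
                     / (t2 (b.2 (inl a)) - t1 (b.1 (inl a))))) *
     (\prod_(i < p) cauchy_sum k1 (t1 (b.1 (inr i)))) *
     (\prod_(i < q) cauchy_sum k2 (t2 (b.2 (inr i))))) =
    \sum_(v : words) xw v * word_weight z t1 t2 v.1.1 v.1.2 v.2 b.1 b.2.
  under eq_bigr do rewrite /cauchy_sum mulr_suml.
  rewrite !bigA_distr_bigA /= big_distrlr /= pair_bigA /= big_distrlr /= pair_bigA /=.
  apply: eq_bigr => v _; rewrite /xw /word_weight mulrACA.
  rewrite [X in _ = X * _]mulrACA -!big_split /=.
  by congr (_ * _ * _); apply: eq_bigr => i _; rewrite mul1r // invfM mulrA.
under [in RHS]eq_bigr do rewrite expand.
rewrite exchange_big /= mulr_sumr.
rewrite [RHS](partition_big word_content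
  (fun I => in_P I && (degree31 I == d))) => [|v _]; last exact: in_P_word_content.
apply: eq_bigr => I /andP[PI /eqP deg_I] /=.
have cardI := card_word_content PI deg_I.
set S := \sum_(b : {ffun SI1 I -> 'I_l1} * {ffun SI2 I -> 'I_l2}
    | bijectiveb b.1 && bijectiveb b.2) \prod_s omega_factor z t1 t2 b.1 b.2 s.
(* All words of content [I] contribute equally, and their number divided by d! p! q! is the factor 1
   / prod I! of [omega]. *)
transitivity (\sum_(v | word_content v == I)
    1 / (d`! * p`! * q`!)%:R * (monomial_value I * S)).
  rewrite sumr_const -[RHS]mulr_natl -cardI /omega -/S natrM.
  set C := (\prod_(j < n) _)%:R; set K := #|_|%:R.
  have : C * K != 0 :> F.
    by rewrite mulrC -natrM cardI !natrM !mulf_neq0.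
  rewrite mulf_eq0 negb_or => /andP[nz1 nz2].
  by rewrite !mul1r invfM !mulrA mulfV // mul1r mulrAC.
apply: eq_bigr => v; rewrite word_content_eq => /and3P[cD cA cB].
rewrite -mulr_sumr; congr (_ * (_ * _)); last first.
  by apply: sum_omega_factor => j; apply/eqP; move: j; apply/forallP.
rewrite /xw (prod_content (x^~ k3)) (prod_content (x^~ k1)) (prod_content (x^~ k2)).
rewrite -!big_split /=; apply: eq_bigr => j _.
rewrite (eqP (forallP cD j)) (eqP (forallP cA j)) (eqP (forallP cB j)).
by rewrite (mulrC (x j k1 ^+ _)).
Qed.

End Words.

(** * Homogeneous components as sums over admissible pairs *)

Lemma sum_tuple_ffun (R : nmodType) (T : finType) (d : nat)
    (H : (forall a : 'I_d, T) -> R) :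
  (forall f g, f =1 g -> H f = H g) ->
  \sum_(k : d.-tuple T | uniq k) H (tnth k) =
  \sum_(f : {ffun 'I_d -> T} | injectiveb f) H f.
Proof.
move=> eqH; rewrite (reindex (fun k : d.-tuple T => [ffun a => tnth k a])) /=.
  apply: eq_big => [k|k _]; last by apply: eqH => a; rewrite ffunE.
  apply/idP/injectiveP => [uk a a'|inj_k]; last first.
    by apply/tuple_uniqP => a a' eq_k; apply: inj_k; rewrite !ffunE.
  by rewrite !ffunE; move: a a'; apply/tuple_uniqP.
exists (fun f : {ffun 'I_d -> T} => [tuple f a | a < d]) => f _.
  by apply: eq_from_tnth => a; rewrite tnth_mktuple ffunE.
by apply/ffunP=> a; rewrite ffunE tnth_mktuple.
Qed.

Section Components.
Variables (F : fieldType) (n l1 l2 : nat).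
Variables (z : 'I_n -> F) (t1 : 'I_l1 -> F) (t2 : 'I_l2 -> F).
Variables (x : 'I_n -> 'I_3 -> F).
Hypothesis fact_neq0 : forall m, (m`!)%:R != 0 :> F.

Lemma omega_component (d : nat) :
  (d <= minn l1 l2)%N ->
  (forall i, cauchy_sum z x k1 (t1 i) != 0) ->
  (forall i, cauchy_sum z x k2 (t2 i) != 0) ->
  \sum_(I | in_P I && (degree31 I == d)) omega z t1 t2 I * monomial_value x I =
  (\prod_i cauchy_sum z x k1 (t1 i)) * (\prod_i cauchy_sum z x k2 (t2 i)) *
  (1 / (d`!)%:R *
   \sum_(km : d.-tuple 'I_l1 * d.-tuple 'I_l2 | admissible km)
     \prod_(a < d) (cauchy_sum z x k3 (t1 (tnth km.1 a))
       / (t2 (tnth km.2 a) - t1 (tnth km.1 a))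
       / (cauchy_sum z x k1 (t1 (tnth km.1 a))
          * cauchy_sum z x k2 (t2 (tnth km.2 a))))).
Proof.
rewrite leq_min => /andP[led1 led2] nz1 nz2.
set G1 := cauchy_sum z x k1; set G2 := cauchy_sum z x k2.
have dp : (d + (l1 - d) = l1)%N by rewrite subnKC.
have dq : (d + (l2 - d) = l2)%N by rewrite subnKC.
rewrite (omega_words z t1 t2 x dp dq fact_neq0) -/G1 -/G2.
set p := (l1 - d)%N; set q := (l2 - d)%N.
(* [w] is what the pair (i, m) leaves after division by all the F_1(t1_i) and F_2(t2_m). *)
pose w (i : 'I_l1) (m : 'I_l2) :=
  cauchy_sum z x k3 (t1 i) / (t2 m - t1 i) / (G1 (t1 i) * G2 (t2 m)).
have card1 : #|'I_l1| = (#|'I_d| + #|'I_p|)%N by rewrite !card_ord.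
have card2 : #|'I_l2| = (#|'I_d| + #|'I_q|)%N by rewrite !card_ord.
transitivity (1 / (d`! * p`! * q`!)%:R *
  ((\prod_i G1 (t1 i)) * (\prod_i G2 (t2 i)) *
  \sum_(b1 : {ffun 'I_d + 'I_p -> 'I_l1} | injectiveb b1)
  \sum_(b2 : {ffun 'I_d + 'I_q -> 'I_l2} | injectiveb b2)
    \prod_(a < d) w (ffun_inl b1 a) (ffun_inl b2 a))).
  congr (_ * _); rewrite pair_big mulr_sumr /=.
  apply: eq_big => [[b1 b2]|[b1 b2]] /=; first by rewrite !bijectiveb_card // card_sum.
  rewrite !bijectiveb_card ?card_sum // => /andP[inj1 inj2].
  (* Reindexing the full products along the bijections splits off the indices outside ['I_d], which
     match the F_1 and F_2 factors of the summand. *)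
  rewrite (reindex b1); last first.
    by apply/onW_bij/inj_card_bij; [exact/injectiveP|rewrite card_sum card1].
  rewrite [X in _ = _ * X * _](reindex b2); last first.
    by apply/onW_bij/inj_card_bij; [exact/injectiveP|rewrite card_sum card2].
  rewrite !big_sumType /= [X in _ = X * _]mulrACA [RHS]mulrAC [RHS]mulrA.
  rewrite -!big_split /=.
  congr (_ * _ * _); apply: eq_bigr => a _; rewrite /w !ffunE.
  by rewrite [RHS]mulrC divfK // mulf_neq0.
rewrite mulrCA; congr (_ * _).
(* The summand depends only on the restrictions to ['I_d], so summing over extensions yields q! and
   p!, leaving 1/d!. *)
have sum2 (b1 : {ffun 'I_d + 'I_p -> 'I_l1}) :=
  @sum_injective_cat F 'I_d 'I_q 'I_l2
    (fun f => \prod_(a < d) w (ffun_inl b1 a) (f a)) card2.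
under eq_bigr do rewrite sum2.
rewrite (@sum_injective_cat F 'I_d 'I_p 'I_l1 (fun g => (#|'I_q|`!)%:R *
  \sum_(f : {ffun 'I_d -> 'I_l2} | injectiveb f) \prod_(a < d) w (g a) (f a))
  card1).
rewrite -mulr_sumr !card_ord !natrM !mulrA; congr (_ * _).
  rewrite !mul1r !invfM mulrAC mulfVK // mulfVK //.
rewrite -(pair_big_dep (fun k : d.-tuple 'I_l1 => uniq k)
  (fun _ (m : d.-tuple 'I_l2) => uniq m)
  (fun k m => \prod_(a < d) w (tnth k a) (tnth m a))) /=.
rewrite -(@sum_tuple_ffun _ _ _ (fun g =>
   \sum_(f : {ffun 'I_d -> 'I_l2} | injectiveb f) \prod_(a < d) w (g a) (f a))).
  apply: eq_bigr => k _; rewrite -(@sum_tuple_ffun _ _ _ (fun f =>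
    \prod_(a < d) w (tnth k a) (f a))) // => f g eq_fg.
  by apply: eq_bigr => a _; rewrite eq_fg.
move=> f g eq_fg; apply: eq_bigr => h _; apply: eq_bigr => a _.
by rewrite eq_fg.
Qed.

(** The change of variables is an identity of fractions in an auxiliary variable. Clearing
    denominators makes it a polynomial identity, which can be evaluated at [c] and divided by the
    nonzero product of the [c - z i]. *)
Lemma cauchy_sumE (u : 'I_3 -> F) (y : 'I_3 -> 'I_n.-1 -> F) (k : 'I_3) (c : F) :
  change_of_variables z x u y -> (forall i, c != z i) ->
  cauchy_sum z x k c =
  u k * (\prod_(j < n.-1) (c - y k j) / \prod_(i < n) (c - z i)).
Proof.
move=> /(_ k) cov ncz.
have cov_poly : \sum_(i < n) (x i k)%:P * \prod_(j < n | j != i) ('X - (z j)%:P)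
    = (u k)%:P * \prod_(j < n.-1) ('X - (y k j)%:P).
  apply/eqP; rewrite -tofrac_eq; apply/eqP.
  have nzX (b : F) : tofrac ('X : {poly F}) - tofrac b%:P != 0.
    by rewrite -tofracB tofrac_eq0 polyXsubC_eq0.
  have nzQ : \prod_(i < n) (tofrac ('X : {poly F}) - tofrac (z i)%:P) != 0.
    by apply/prodf_neq0 => i _.
  move/(congr1 (fun e =>
    e * \prod_(i < n) (tofrac ('X : {poly F}) - tofrac (z i)%:P))): cov.
  rewrite !mulrA divfK // mulr_suml => cov.
  rewrite rmorph_sum rmorphM rmorph_prod /=.
  under [X in _ = _ * X]eq_bigr do rewrite rmorphB.
  rewrite -cov; apply: eq_bigr => i _; rewrite rmorphM rmorph_prod /=.
  under eq_bigr do rewrite rmorphB /=.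
  by rewrite [X in _ = _ * X](bigD1 i isT) mulrA (divfK (nzX _)).
move/(congr1 (horner^~ c)): cov_poly.
rewrite hornerM horner_sum hornerC horner_prod.
under [X in _ = _ * X]eq_bigr do rewrite hornerXsubC.
move=> cov_c; rewrite mulrA -cov_c mulr_suml; apply: eq_bigr => i _.
rewrite hornerM hornerC horner_prod [X in _ = _ / X](bigD1 i) //=.
under [X in _ = _ * X / _]eq_bigr do rewrite hornerXsubC.
rewrite -mulrA; congr (_ * _); rewrite invfM mulrCA mulfV ?mulr1 //.
by apply/prodf_neq0 => j _; rewrite subr_eq0.
Qed.

(** The collection [I] contributes a monomial of x_3-degree [degree31 I], so extracting a component
    amounts to filtering the collections. This is checked coefficient by coefficient before
    evaluation. *)
Lemma at_x_weight_component (d : nat) :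
  at_x x (degree_component d (weight_function z t1 t2)) =
  \sum_(I | in_P I && (degree31 I == d)) omega z t1 t2 I * monomial_value x I.
Proof.
pose exponent (I : collection n l1 l2) : 'X_{1..#|{: 'I_n * 'I_3}|} :=
  [multinom (I ((enum_val i).1, var_root (enum_val i).2) : nat) | i < _].
have exponentE (I : collection n l1 l2) : \prod_(j < n) (xvar F j k1 ^+ I (j, E21)
    * xvar F j k3 ^+ I (j, E31) * xvar F j k2 ^+ I (j, E32)) = 'X_[exponent I].
  rewrite mpolyXE_id (reindex enum_rank) /=; last first.
    by apply/onW_bij; exists enum_val; [exact: enum_rankK|exact: enum_valK].
  under [RHS]eq_bigr do rewrite mnmE enum_rankK.
  transitivity (\prod_(jk : 'I_n * 'I_3)
      xvar F jk.1 jk.2 ^+ I (jk.1, var_root jk.2));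
    last by apply: eq_bigr => -[].
  rewrite -(pair_bigA _ (fun j k => xvar F j k ^+ I (j, var_root k))) /=.
  by apply: eq_bigr => j _; rewrite big_k /=.
have deg_exponent (I : collection n l1 l2) : x3degree (exponent I) = degree31 I.
  by apply: eq_bigr => j _; rewrite mnmE enum_rankK.
have meval_exponent (I : collection n l1 l2) : at_x x 'X_[exponent I] = monomial_value x I.
  rewrite -exponentE /at_x rmorph_prod; apply: eq_bigr => j _.
  by rewrite !rmorphM !rmorphXn /= !mevalXU !enum_rankK.
have compE p : degree_component d p =
    \sum_(m <- msupp p) (if x3degree m == d then p@_m else 0) *: 'X_[m].
  rewrite /degree_component big_mkcond; apply: eq_bigr => m _.
  by case: ifP => // _; rewrite scale0r.
have mcoeff_comp p m :
    (degree_component d p)@_m = if x3degree m == d then p@_m else 0.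
  rewrite compE raddf_sum /=; under eq_bigr do rewrite mcoeffZ mcoeffX.
  case: (boolP (m \in msupp p)) => [m_p|m_p].
    rewrite (bigD1_seq m) ?msupp_uniq //= eqxx mulr1 big1 ?addr0 // => m' /negPf ->.
    by rewrite mulr0.
  rewrite big_seq big1 ?(memN_msupp_eq0 m_p) ?if_same // => m' m'_p.
  by rewrite (_ : (m' == m) = false) ?mulr0 //; apply: contraNF m_p => /eqP <-.
have -> : degree_component d (weight_function z t1 t2) =
    \sum_(I | in_P I && (degree31 I == d)) omega z t1 t2 I *: 'X_[exponent I].
  apply/mpolyP=> m; rewrite mcoeff_comp /weight_function.
  under eq_bigr do rewrite exponentE.
  rewrite !raddf_sum /= [RHS]big_mkcondr /=.
  case: eqP => [deg_m|deg_m]; last first.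
    rewrite big1 // => I _; case: ifP => // /eqP deg_I.
    rewrite mcoeffZ mcoeffX; case: (exponent I =P m) => [eq_m|_];
    last by rewrite mulr0.
    by case: deg_m; rewrite -eq_m deg_exponent.
  apply: eq_bigr => I _; case: ifP => // /eqP deg_I.
  rewrite mcoeffZ mcoeffX; case: (exponent I =P m) => [eq_m|_];
    last by rewrite mulr0.
  by case: deg_I; rewrite -deg_exponent eq_m.
rewrite /at_x raddf_sum; apply: eq_bigr => I _.
by rewrite /= mevalZ -meval_exponent.
Qed.

Lemma at_x_weight :
  at_x x (weight_function z t1 t2) =
  \sum_(I | in_P I) omega z t1 t2 I * monomial_value x I.
Proof.
rewrite /at_x raddf_sum; apply: eq_bigr => I _.
rewrite /= mevalZ rmorph_prod; congr (_ * _); apply: eq_bigr => j _.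
by rewrite !rmorphM !rmorphXn /= !mevalXU !enum_rankK.
Qed.

Lemma degree31_le (I : collection n l1 l2) :
  in_P I -> (degree31 I <= minn l1 l2)%N.
Proof.
case/andP=> /eqP sum1 /eqP sum2.
rewrite leq_min -[X in (_ <= X)%N && _]sum1 -[X in _ && (_ <= X)%N]sum2.
by rewrite !big_split /= leq_addl leq_addr.
Qed.

End Components.

(** * Evaluating the components in the variables u and y *)

Section Expansion.
Variables (F : fieldType) (n l1 l2 : nat).
Variables (z : 'I_n -> F) (t1 : 'I_l1 -> F) (t2 : 'I_l2 -> F).
Variables (x : 'I_n -> 'I_3 -> F) (u : 'I_3 -> F) (y : 'I_3 -> 'I_n.-1 -> F).
Hypothesis fact_neq0 : forall m, (m`!)%:R != 0 :> F.
Hypothesis cov : change_of_variables z x u y.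
Hypotheses (u1_neq0 : u k1 != 0) (u2_neq0 : u k2 != 0).
Hypotheses (t1z : forall i s, t1 i != z s) (t2z : forall i s, t2 i != z s).
Hypotheses (t1y : forall i j, t1 i != y k1 j) (t2y : forall i j, t2 i != y k2 j).

Definition prefactor : F :=
  u k1 ^+ l1 * u k2 ^+ l2 *
  ((\prod_(j < n.-1) (P1 t1 (y k1 j) * P2 t2 (y k2 j)))
   / \prod_(s < n) (P1 t1 (z s) * P2 t2 (z s))).

Definition summand (d : nat) : F :=
  1 / (d`!)%:R * (u k3 / (u k1 * u k2)) ^+ d *
  \sum_(km : d.-tuple 'I_l1 * d.-tuple 'I_l2 | admissible km)
     Xi z t1 t2 y km.

Lemma prod_subr_neq0 (N : nat) (a : F) (b : 'I_N -> F) :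
  (forall j, a != b j) -> \prod_(j < N) (a - b j) != 0.
Proof. by move=> neq; apply/prodf_neq0 => j _; rewrite subr_eq0. Qed.

Lemma prod_cauchy_sum (l : nat) (t : 'I_l -> F) (k : 'I_3) :
  (forall i s, t i != z s) ->
  \prod_(i < l) cauchy_sum z x k (t i) =
  u k ^+ l * (\prod_(j < n.-1) \prod_(i < l) (t i - y k j)
              / \prod_(s < n) \prod_(i < l) (t i - z s)).
Proof.
move=> tz; under eq_bigr do rewrite (cauchy_sumE k cov (tz _)).
rewrite big_split prodr_const card_ord big_split prodfV; congr (_ * (_ / _)).
  exact: exchange_big.
exact: exchange_big.
Qed.

Lemma prefactorE :
  (\prod_i cauchy_sum z x k1 (t1 i)) * (\prod_i cauchy_sum z x k2 (t2 i)) =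
  prefactor.
Proof.
rewrite !prod_cauchy_sum // mulrACA /prefactor !big_split /=; congr (_ * _).
by rewrite invfM mulrACA.
Qed.

Lemma cauchy_sum1_neq0 i : cauchy_sum z x k1 (t1 i) != 0.
Proof.
rewrite (cauchy_sumE k1 cov) //.
by rewrite mulf_neq0 // mulf_neq0 ?invr_eq0 // prod_subr_neq0.
Qed.

Lemma cauchy_sum2_neq0 i : cauchy_sum z x k2 (t2 i) != 0.
Proof.
rewrite (cauchy_sumE k2 cov) //.
by rewrite mulf_neq0 // mulf_neq0 ?invr_eq0 // prod_subr_neq0.
Qed.

(** In F_3(t1_i) / (F_1(t1_i) F_2(t2_m)) the products over z at t1_i cancel and the one at t2_m
    moves to the numerator; what remains is u_3/(u_1 u_2) times one factor of [Xi]. *)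
Lemma component_summand (d : nat) :
  (d <= minn l1 l2)%N ->
  \sum_(I | in_P I && (degree31 I == d)) omega z t1 t2 I * monomial_value x I =
  prefactor * summand d.
Proof.
move=> led.
rewrite (omega_component fact_neq0 led cauchy_sum1_neq0 cauchy_sum2_neq0).
rewrite prefactorE; congr (_ * _); rewrite /summand -[RHS]mulrA; congr (_ * _).
rewrite mulr_sumr; apply: eq_bigr => km _; rewrite /Xi.
rewrite -[X in _ ^+ X]card_ord -prodr_const -big_split /=.
apply: eq_bigr => a _; move: (tnth km.1 a) (tnth km.2 a) => i m.
rewrite (cauchy_sumE k1 cov) // (cauchy_sumE k2 cov) // (cauchy_sumE k3 cov) //.
rewrite big_split /= prodfV big_split /=.
have := prod_subr_neq0 (t1z i); have := prod_subr_neq0 (t2z m).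
have := prod_subr_neq0 (t1y i); have := prod_subr_neq0 (t2y m).
(* The products, and then the inverse of t2_m - t1_i, become atoms, so that a rational identity is
   left for [field]. *)
move: (\prod_(j < n.-1) (t2 m - _)) (\prod_(j < n.-1) (t1 i - y k1 _)).
move: (\prod_(j < n.-1) (t1 i - y k3 _)) (\prod_(s < n) _) (\prod_(s < n) _).
move=> Y3 Z1 Z2 Y2 Y1 Y2n Y1n Z2n Z1n; rewrite !mul1r.
move: (t2 m - t1 i)^-1 => e.
by field; rewrite ?Y2n ?Y1n ?Z2n ?Z1n ?u1_neq0 ?u2_neq0.
Qed.

Lemma summand0 : summand 0 = 1.
Proof.
rewrite /summand fact0 divr1 expr0 !mul1r (big_pred1 ([tuple], [tuple])).
  by rewrite /Xi big_ord0.
by case=> k m; rewrite (tuple0 k) (tuple0 m); apply/esym/eqP.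
Qed.

Lemma weight_expansion :
  at_x x (weight_function z t1 t2) =
  prefactor * (1 + \sum_(1 <= d < (minn l1 l2).+1) summand d).
Proof.
rewrite at_x_weight -summand0 -(big_ltn (m := 0)) // big_mkord mulr_sumr.
(* The collections are sorted by degree; [inord] is faithful since a degree never exceeds min(l1,
   l2). *)
rewrite (partition_big (fun I => inord (degree31 I) : 'I_(minn l1 l2).+1) xpredT) //=.
apply: eq_bigr => d _; rewrite -component_summand ?leq_ord //.
apply: eq_bigl => I; have [PI|//] := boolP (in_P I).
by rewrite -val_eqE /= inordK // ltnS degree31_le.
Qed.

End Expansion.

(** * Genericity of the indeterminates *)

Section Indeterminates.
Variables (R : realType) (n l1 l2 : nat).
Implicit Types v w : indets n l1 l2.

(** The coefficient at [U_(v)] separates the two sides. Taking for [p] zero, a constant or another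
    indeterminate gives the inequalities required by the expansion. *)
Lemma tofracX_neq (N : nat) (v : 'I_N) (p : {mpoly R[i][N]}) :
  p@_U_(v) = 0 -> tofrac ('X_v : {mpoly R[i][N]}) != tofrac p.
Proof.
move=> p0; rewrite tofrac_eq; apply/eqP => /(congr1 (mcoeff U_(v)%MM))/eqP.
by rewrite p0 mcoeffXU eqxx oner_eq0.
Qed.

Lemma indet_neq0 v : indet R v != 0.
Proof. by rewrite -[0]tofrac0 tofracX_neq // mcoeff0. Qed.

Lemma indet_neq_const v (c : R[i]) : indet R v != const_ n l1 l2 c.
Proof. by rewrite tofracX_neq // mcoeffC mnm1_eq0 mulr0. Qed.

Lemma indet_inj : injective (@indet R n l1 l2).
Proof.
move=> v w /eqP; apply: contraTeq => neq_vw.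
rewrite tofracX_neq // mcoeffXU (inj_eq enum_rank_inj) eq_sym.
by rewrite (negPf neq_vw).
Qed.

Lemma ratfun_fact_neq0 (m : nat) : (m`!)%:R != 0 :> ratfun R n l1 l2.
Proof.
rewrite -tofrac1 -tofracMn tofrac_eq0 -mpolyC_nat mpolyC_eq0.
by rewrite Num.Theory.pnatr_eq0 -lt0n fact_gt0.
Qed.

End Indeterminates.

Theorem theorem6p6p3 (R : realType) (n l1 l2 : nat) (c : 'I_n -> R[i])
    (x : 'I_n -> 'I_3 -> ratfun R n l1 l2) :
  (0 < n)%N ->
  injective c ->
  let z := fun s : 'I_n => const_ n l1 l2 (c s) in
  let t1 := @t1_ R n l1 l2 in
  let t2 := @t2_ R n l1 l2 in
  let u := @u_ R n l1 l2 in
  let y := @y_ R n l1 l2 in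
  change_of_variables z x u y ->
  let Psi := at_x x (weight_function z t1 t2) in
  let Psi_component := fun d : nat =>
    at_x x (degree_component d (weight_function z t1 t2)) in
  let prefactor :=
    u k1 ^+ l1 * u k2 ^+ l2 *
    ((\prod_(j < n.-1) (P1 t1 (y k1 j) * P2 t2 (y k2 j)))
     / \prod_(s < n) (P1 t1 (z s) * P2 t2 (z s))) in
  let summand := fun d : nat =>
    1 / (d`!)%:R * (u k3 / (u k1 * u k2)) ^+ d *
    \sum_(km : d.-tuple 'I_l1 * d.-tuple 'I_l2 | admissible km)
       Xi z t1 t2 y km in
  [/\ Psi = prefactor * (1 + \sum_(1 <= d < (minn l1 l2).+1) summand d),
      Psi_component 0%N = prefactor
    & forall d : nat, (1 <= d <= minn l1 l2)%N ->
        Psi_component d = prefactor * summand d].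
Proof.
move=> _ _ z t1 t2 u y cov Psi Psi_component pre smd.
(* The t's and y's are distinct indeterminates, the u's are nonzero and the z's are constants, so
   every denominator is nonzero. *)
have t1y i j : t1 i != y k1 j by rewrite (inj_eq (@indet_inj _ _ _ _)).
have t2y i j : t2 i != y k2 j by rewrite (inj_eq (@indet_inj _ _ _ _)).
have exp := weight_expansion (t1 := t1) (t2 := t2)
  (@ratfun_fact_neq0 R n l1 l2) cov (indet_neq0 _ _) (indet_neq0 _ _)
  (fun _ _ => indet_neq_const _ _) (fun _ _ => indet_neq_const _ _) t1y t2y.
have comp := component_summand (t1 := t1) (t2 := t2)
  (@ratfun_fact_neq0 R n l1 l2) cov (indet_neq0 _ _) (indet_neq0 _ _)
  (fun _ _ => indet_neq_const _ _) (fun _ _ => indet_neq_const _ _) t1y t2y.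
split=> [||d /andP[_ led]].
- exact: exp.
- by rewrite /Psi_component at_x_weight_component comp // summand0 mulr1.
- by rewrite /Psi_component at_x_weight_component comp.
Qed.
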